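(* Let $R$ be a Dedekind domain with a countable number of maximal ideals. A torsion-free $R$-module $M$ is isomorphic to a direct sum of ideals of $R$ if it is the union of a countable ascending chain $$0 = M_0 \leq M_1 \leq \dots \leq M_n \leq \dots \quad (n<\omega)$$ of submodules, such that the following are satisfied for every $n<\omega$: (i) $M_n$ is isomorphic to a direct sum of ideals of $R$, and (ii) $M_n$ is pure in $M$.
   Context: A Dedekind domain is an integral domain all of whose ideals are projective. A submodule $N$ of an $R$-module $M$ is pure in $M$ if every finite system of equations $\sum_{j=1}^m r_{ij}x_j = a_i \in N$ ($i=1,\dots,n$), with $r_{ij}\in R$, is solvable in $N$ whenever it is solvable in $M$. Countable means finite or countably infinite. Direct sums of ideals are direct sums of (arbitrarily many) ideals of $R$ regarded as $R$-modules. *)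

(* Defs.v *)
From HB Require Import structures.
From mathcomp Require Import all_boot all_order all_algebra.
From mathcomp Require Import boolp classical_sets functions cardinality.

Set Implicit Arguments.
Unset Strict Implicit.
Unset Printing Implicit Defensive.

Import GRing.Theory.

Local Open Scope ring_scope.

(* A submodule of V is a [submodClosed V], a boolean predicate closed under the
   module operations; classically no submodule is lost ([asbool]).  [submodule S]
   is S regarded as an R-module in its own right. *)
Section SubmoduleType.
Variables (R : pzRingType) (V : lmodType R) (S : submodClosed V).

Definition submodule : Type := {x : V | x \in S}.

HB.instance Definition _ := SubChoice.on submodule.
HB.instance Definition _ := [SubChoice_isSubLmodule of submodule by <:].

End SubmoduleType.

(* R is commutative, so its ideals are the submodules of the regular module. *)
Notation ideal R := (submodClosed R^o).

Definition maximal_ideal (R : comNzRingType) (J : ideal R) : Prop :=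
  (exists x, x \notin J) /\
  forall K : ideal R,
    {subset J <= K} -> (exists x, x \notin K) -> {subset K <= J}.

Definition projective (R : pzRingType) (P : lmodType R) : Prop :=
  forall (A B : lmodType R) (g : {linear A -> B}) (f : {linear P -> B}),
    (forall b, exists a, g a = b) ->
    exists h : {linear P -> A}, forall x, g (h x) = f x.

Definition dedekind_domain (R : idomainType) : Prop :=
  forall J : ideal R, projective (submodule J).

Definition torsion_free (R : idomainType) (M : lmodType R) : Prop :=
  forall (r : R) (x : M), r *: x = 0 -> r = 0 \/ x = 0.

(* The i-th equation is \sum_j r i j *: x j = a i. *)
Definition pure (R : pzRingType) (M : lmodType R) (N : submodClosed M) : Prop :=
  forall (n m : nat) (r : 'M[R]_(n, m)) (a : 'I_n -> M),
    (forall i, a i \in N) ->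
    (exists x : 'I_m -> M, forall i, \sum_j r i j *: x j = a i) ->
    exists x : 'I_m -> M,
      (forall j, x j \in N) /\ forall i, \sum_j r i j *: x j = a i.

(* The external direct sum of a family of ideals J, as the R-module of the
   finitely supported families of elements of R with i-th component in J i. *)
Section DirectSum.
Variables (R : comNzRingType) (I : Type) (J : I -> ideal R).

Definition in_direct_sum : {pred I -> R^o} :=
  fun f => `[< (forall i, f i \in J i) /\ finite_set [set i | f i <> 0] >].

Fact in_direct_sum_closed : subsemimod_closed in_direct_sum.
Proof.
split; first split.
- apply/asboolP; split=> [i|]; first exact: rpred0.
  by apply: (@sub_finite_set _ _ set0) => // i /(_ erefl).
- move=> f g /asboolP[fJ ff] /asboolP[gJ fg]; apply/asboolP; split=> [i|].
    exact: rpredD (fJ i) (gJ i).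
  apply: (@sub_finite_set _ _ ([set i | f i <> 0] `|` [set i | g i <> 0])).
    move=> i /= h; apply: contrapT => /not_orP[/contrapT f0 /contrapT g0].
    by apply: h; change (f i + g i = 0); rewrite f0 g0 addr0.
  by rewrite finite_setU.
- move=> r f /asboolP[fJ ff]; apply/asboolP; split=> [i|].
    exact: rpredZ (fJ i).
  apply: sub_finite_set ff => i /= h f0.
  by apply: h; change (r *: f i = 0); rewrite f0 scaler0.
Qed.

HB.instance Definition _ :=
  GRing.isSubmodClosed.Build R (I -> R^o) in_direct_sum in_direct_sum_closed.

Definition direct_sum : lmodType R := submodule in_direct_sum.

End DirectSum.

Definition iso_direct_sum_of_ideals (R : comNzRingType) (M : lmodType R) : Prop :=
  exists (I : Type) (J : I -> ideal R) (f : {linear M -> direct_sum J}),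
    bijective f.

(* Main.v *)
(* Hill's argument.  Call a submodule A of M good if, for every n, A + N n is
   pure in M and A meets N n in the sum of a subset of the summands of a fixed
   decomposition of N n.  Countably many maximal ideals make the quotient field
   of R countably generated, so pure hulls of finitely many elements are
   countably generated, and each good A and each x lie in a good A' with A'/A
   countably generated.  Every element of A + N n outside A is detected by a
   functional on A + N n vanishing on A, and this survives the adjunction of
   finitely many elements; so, adjoining the generators of A' one at a time,
   each rank-one factor is isomorphic to an ideal, hence projective, and splits
   off.  Zorn's lemma on the partial decompositions of M whose sum is good
   finishes the proof.

   A rank-one summand is represented by a nonzero element b, as the line of all
   x with r x = s b for some r <> 0. *)

From HB Require Import structures.
Require Import Defs.
From mathcomp Require Import all_boot all_order all_algebra.
From mathcomp Require Import boolp classical_sets functions cardinality fsbigop.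

Set Implicit Arguments.
Unset Strict Implicit.
Unset Printing Implicit Defensive.

Import GRing.Theory.

Local Open Scope classical_set_scope.
Local Open Scope ring_scope.

(** * Submodules *)

Definition directed (T V : Type) (D : set T) (A : T -> set V) : Prop :=
  D !=set0 /\ forall i j, D i -> D j ->
    exists k, [/\ D k, A i `<=` A k & A j `<=` A k].

Lemma total_on_directed (T V : Type) (F : set (set T)) (G : set T -> set V) :
  F !=set0 -> total_on F subset -> {homo G : X Y / X `<=` Y} -> directed F G.
Proof.
move=> F0 tF mG; split=> // X Y FX FY.
by have [XY|YX] := tF _ _ FX FY; [exists Y | exists X]; split=> //; exact: mG.
Qed.

Section Submodules.
Variables (R : pzRingType) (V : lmodType R).
Implicit Types (A B X Y : set V).

Definition submod A : Prop :=
  A 0 /\ forall r x y, A x -> A y -> A (r *: x + y).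

Lemma submod0 A : submod A -> A 0. Proof. by case. Qed.

Lemma submod_linear A r x y : submod A -> A x -> A y -> A (r *: x + y).
Proof. by case=> _; exact. Qed.

Lemma submodZ A r x : submod A -> A x -> A (r *: x).
Proof.
move=> sA Ax; rewrite -[_ *: _]addr0.
by apply: submod_linear => //; exact: submod0.
Qed.

Lemma submodD A x y : submod A -> A x -> A y -> A (x + y).
Proof. by move=> sA Ax; rewrite -[x]scale1r; exact: submod_linear. Qed.

Lemma submodN A x : submod A -> A x -> A (- x).
Proof. by move=> sA Ax; rewrite -scaleN1r; exact: submodZ. Qed.

Lemma submodB A x y : submod A -> A x -> A y -> A (x - y).
Proof. by move=> sA Ax Ay; apply: submodD => //; exact: submodN. Qed.

Lemma submod_sum A (I : Type) (s : seq I) (P : pred I) (F : I -> V) :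
  submod A -> (forall i, P i -> A (F i)) -> A (\sum_(i <- s | P i) F i).
Proof.
move=> sA AF; apply: big_ind => //; first exact: submod0.
by move=> x y; exact: submodD.
Qed.

Lemma submod_set0 : submod [set (0 : V)].
Proof. by split=> //= r x y -> ->; rewrite scaler0 addr0. Qed.

Lemma submod_setT : submod [set: V]. Proof. by []. Qed.

Lemma submod_submodClosed (S : submodClosed V) : submod [set x | x \in S].
Proof. by split=> [|r x y xS yS] /=; rewrite ?rpred0// rpredD// rpredZ. Qed.

Lemma submod_bigcup (T : Type) (D : set T) (A : T -> set V) : directed D A ->
  (forall i, D i -> submod (A i)) -> submod (\bigcup_(i in D) A i).
Proof.
move=> [[i Di] dirA] sA; split=> [|r x y [j Dj Ax] [k Dk Ay]].
  by exists i => //; exact: submod0 (sA i Di).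
have [m [Dm /(_ _ Ax) ? /(_ _ Ay) ?]] := dirA _ _ Dj Dk.
by exists m => //; apply: submod_linear => //; exact: sA.
Qed.

Definition lspan X : set V := smallest submod X.

Lemma submod_lspan X : submod (lspan X).
Proof.
split=> [A [sA _]|r x y Xx Xy A [sA XA]]; first exact: submod0.
by apply: submod_linear => //; [exact: Xx | exact: Xy].
Qed.

Lemma sub_lspan X : X `<=` lspan X. Proof. exact: sub_gen_smallest. Qed.

Lemma lspan_sub X A : submod A -> X `<=` A -> lspan X `<=` A.
Proof. exact: smallest_sub. Qed.

Lemma lspan_id A : submod A -> lspan A = A. Proof. exact: smallest_id. Qed.

Lemma lspan_mono : {homo lspan : X Y / X `<=` Y}.
Proof. by move=> X Y; apply: sub_smallest2r; exact: submod_lspan. Qed.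

Lemma lspan_set0 : lspan set0 = [set 0].
Proof.
apply/seteqP; split=> [|_ ->]; last exact: submod0 (submod_lspan _).
by apply: lspan_sub; [exact: submod_set0 |].
Qed.

Lemma lspan_setU X Y x : lspan (X `|` Y) x ->
  exists a b, [/\ lspan X a, lspan Y b & x = a + b].
Proof.
have sX := submod_lspan X; have sY := submod_lspan Y.
pose XY := [set x | exists a b, [/\ lspan X a, lspan Y b & x = a + b]].
apply: (@lspan_sub _ XY).
  split=> [|r _ _ [a [b [Xa Yb ->]]] [a' [b' [Xa' Yb' ->]]]].
    by exists 0, 0; rewrite addr0; split=> //; exact: submod0.
  exists (r *: a + a'), (r *: b + b'); rewrite scalerDr addrACA.
  by split=> //; [exact: (submod_linear r sX) | exact: (submod_linear r sY)].
move=> z [Xz|Yz].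
  exists z, 0; rewrite addr0.
  by split=> //; [exact: sub_lspan | exact: submod0].
exists 0, z; rewrite add0r.
by split=> //; [exact: submod0 | exact: sub_lspan].
Qed.

Lemma lspan_submodU A B x : submod A -> submod B -> lspan (A `|` B) x ->
  exists a b, [/\ A a, B b & x = a + b].
Proof. by move=> sA sB /lspan_setU; rewrite !lspan_id. Qed.

Lemma lspan_set1 g x : lspan [set g] x -> exists r, x = r *: g.
Proof.
apply: (@lspan_sub _ [set x | exists r, x = r *: g]) => [|_ ->]; last first.
  by exists 1; rewrite scale1r.
split=> [|c _ _ [r ->] [s ->]]; first by exists 0; rewrite scale0r.
by exists (c * r + s); rewrite scalerDl scalerA.
Qed.

Lemma lspan_bigcup (T : Type) (D : set T) (A : T -> set V) : directed D A ->
  lspan (\bigcup_(i in D) A i) `<=` \bigcup_(i in D) lspan (A i).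
Proof.
move=> [D0 dirA]; apply: lspan_sub => [|x [i Di /sub_lspan Ax]]; last first.
  by exists i.
apply: submod_bigcup => [|i _]; last exact: submod_lspan.
split=> // i j Di Dj; have [k [Dk ik jk]] := dirA _ _ Di Dj.
by exists k; split=> //; exact: lspan_mono.
Qed.

Lemma lspan_finitary X Y x : lspan (X `|` Y) x ->
  exists2 s : seq V, [set` s] `<=` Y & lspan (X `|` [set` s]) x.
Proof.
pose D : set (seq V) := [set s | [set` s] `<=` Y].
suff : lspan (X `|` Y) `<=` \bigcup_(s in D) lspan (X `|` [set` s]).
  by move=> /[apply] -[s Ys sx]; exists s.
apply: lspan_sub => [|z [Xz|Yz]].
- apply: submod_bigcup => [|s _]; last exact: submod_lspan.
  split=> [|s t Ds Dt]; first by exists [::].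
  exists (s ++ t); split=> [z /=|z|z].
  + by rewrite mem_cat => /orP[/Ds|/Dt].
  + by apply: lspan_mono => w [|sw]; [left | right; rewrite /= mem_cat sw].
  + by apply: lspan_mono => w [|sw]; [left | right; rewrite /= mem_cat sw orbT].
- by exists [::] => //; apply: sub_lspan; left.
- exists [:: z] => [w|]; first by rewrite /= inE => /eqP ->.
  by apply: sub_lspan; right; rewrite /= mem_head.
Qed.

Definition submod_pred A & submod A : {pred V} := fun x => `[< A x >].

Fact submod_pred_closed A (sA : submod A) : subsemimod_closed (submod_pred sA).
Proof.
split; first split.
- by apply/asboolP; exact: submod0.
- by move=> x y /asboolP Ax /asboolP Ay; apply/asboolP; exact: submodD.
- by move=> r x /asboolP Ax; apply/asboolP; exact: submodZ.
Qed.

HB.instance Definition _ A (sA : submod A) :=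
  GRing.isSubmodClosed.Build R V (submod_pred sA) (submod_pred_closed sA).

Lemma in_submod_pred A (sA : submod A) x : (x \in submod_pred sA) <-> A x.
Proof. by split=> /asboolP. Qed.

End Submodules.

#[local] Hint Resolve submod_lspan : core.

(** * Linear maps on submodules *)

Section LinearOn.
Variables (R : pzRingType) (V U : lmodType R).
Implicit Types (A B W : set V) (f g : V -> U).

Definition linear_on W f : Prop :=
  forall r x y, W x -> W y -> f (r *: x + y) = r *: f x + f y.

Lemma linear_on_sub A B f : A `<=` B -> linear_on B f -> linear_on A f.
Proof. by move=> AB lf r x y /AB Bx /AB By; exact: lf. Qed.

Lemma linear_onD W f x y : linear_on W f -> W x -> W y -> f (x + y) = f x + f y.
Proof. by move=> lf Wx Wy; rewrite -[x in LHS]scale1r lf// scale1r. Qed.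

Lemma linear_onB W f x y : linear_on W f -> W x -> W y -> f (x - y) = f x - f y.
Proof. by move=> lf Wx Wy; rewrite addrC -scaleN1r lf// scaleN1r addrC. Qed.

Lemma linear_on0 W f : submod W -> linear_on W f -> f 0 = 0.
Proof.
by move=> /submod0 W0 lf; rewrite -[X in f X](subrr 0) (linear_onB lf) ?subrr.
Qed.

Lemma linear_onZ W f r x : submod W -> linear_on W f -> W x ->
  f (r *: x) = r *: f x.
Proof.
move=> sW lf Wx; rewrite -[_ *: _]addr0 lf ?(linear_on0 sW lf) ?addr0//.
exact: submod0.
Qed.

Lemma linear_on_sum W f (I : Type) (s : seq I) (F : I -> V) :
  submod W -> linear_on W f -> (forall i, W (F i)) ->
  f (\sum_(i <- s) F i) = \sum_(i <- s) f (F i).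
Proof.
move=> sW lf WF; elim: s => [|i s IH].
  by rewrite !big_nil (linear_on0 sW).
by rewrite !big_cons (linear_onD lf) ?IH//; exact: submod_sum.
Qed.

Lemma submod_image W f : submod W -> linear_on W f -> submod (f @` W).
Proof.
move=> sW lf; split=> [|r _ _ [x Wx <-] [y Wy <-]].
  by exists 0; [exact: submod0 | exact: linear_on0 lf].
by exists (r *: x + y); [exact: submod_linear | exact: lf].
Qed.

Lemma linear_on_glue A B f g : submod A -> submod B ->
  linear_on A f -> linear_on B g -> (forall x, A x -> B x -> f x = g x) ->
  exists h, [/\ linear_on (lspan (A `|` B)) h,
    forall x, A x -> h x = f x & forall x, B x -> h x = g x].
Proof.
move=> sA sB lf lg fg.
pose summands x := [set a | A a /\ B (x - a)]; pose p x := xget 0 (summands x).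
have pP x : lspan (A `|` B) x -> A (p x) /\ B (x - p x).
  move=> /(lspan_submodU sA sB)[a [b [Aa Bb ->]]].
  apply: (@xgetPex _ 0 (summands _)).
  by exists a; rewrite /summands /= addrC addKr.
pose h x := f (p x) + g (x - p x).
have hE a b : A a -> B b -> h (a + b) = f a + g b.
  move=> Aa Bb; rewrite /h; have [|Ap Bp] := pP (a + b).
    by apply: (submodD (submod_lspan _)); apply: sub_lspan; [left | right].
  have pbE : a + b - p (a + b) - b = - (p (a + b) - a).
    by rewrite addrAC addrK opprB.
  have Bpa : B (p (a + b) - a).
    by rewrite -[_ - a]opprK -pbE; exact/(submodN sB)/(submodB sB).
  apply/eqP; rewrite -subr_eq0 opprD addrACA.
  rewrite -(linear_onB lf)// -(linear_onB lg)// fg//; last exact: submodB.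
  rewrite -(linear_onD lg)//; last exact: submodB.
  by rewrite pbE subrr (linear_on0 sB lg).
exists h; split=> [r x y|x Ax|x Bx]; last 2 first.
- by rewrite -[x in LHS]addr0 hE ?(linear_on0 sB lg) ?addr0//; exact: submod0.
- by rewrite -[x in LHS]add0r hE ?(linear_on0 sA lf) ?add0r//; exact: submod0.
move=> /(lspan_submodU sA sB)[a [b [Aa Bb ->]]].
move=> /(lspan_submodU sA sB)[a' [b' [Aa' Bb' ->]]].
rewrite scalerDr addrACA !hE ?lf ?lg ?scalerDr 1?addrACA//.
  exact: submod_linear.
exact: submod_linear.
Qed.

End LinearOn.

Section Functionals.
Variables (R : pzRingType) (V : lmodType R).
Implicit Types (W : set V) (f : V -> R).

Definition functional_on W f : Prop := linear_on W (f : V -> R^o).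

Lemma functional_onB W f x y : functional_on W f -> W x -> W y ->
  f (x - y) = f x - f y.
Proof. exact: linear_onB. Qed.

Lemma functional_on0 W f : submod W -> functional_on W f -> f 0 = 0.
Proof. exact: linear_on0. Qed.

Lemma functional_onZ W f r x : submod W -> functional_on W f -> W x ->
  f (r *: x) = r * f x.
Proof. exact: linear_onZ. Qed.

Lemma functional_on_sum_single W f (I : eqType) (s : seq I) (y : I -> V) j :
  submod W -> functional_on W f -> uniq s -> (forall i, W (y i)) ->
  (forall i, i \in s -> i != j -> f (y i) = 0) ->
  f (\sum_(i <- s) y i) = if j \in s then f (y j) else 0.
Proof.
move=> sW lf us Wy fy0; rewrite (linear_on_sum _ sW lf)//; case: ifPn => js.
  by rewrite (bigD1_seq j)//= big_seq_cond big1 ?addr0// => i /andP[/fy0].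
by rewrite big_seq big1// => i si; apply: fy0 => //; apply: contraNneq js => <-.
Qed.

End Functionals.

Section FgProjective.
Variables (R : pzRingType) (V U : lmodType R).

(* The dual basis lemma turned into a definition. *)
Definition fg_projective (P : set V) : Prop :=
  exists n (e : 'I_n -> V) (f : 'I_n -> V -> R),
    [/\ forall i, P (e i), forall i, functional_on P (f i) &
        forall x, P x -> x = \sum_i f i x *: e i].

Lemma fg_projective_section (W : set U) (phi : U -> V) :
  submod W -> linear_on W phi -> fg_projective (phi @` W) ->
  exists sigma, linear_on (phi @` W) sigma /\
    forall y, (phi @` W) y -> W (sigma y) /\ phi (sigma y) = y.
Proof.
move=> sW lphi [n [e [f [We lf eE]]]].
have /choice[w wP] : forall i, exists w, W w /\ phi w = e i.
  by move=> i; have [w] := We i; exists w.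
exists (fun y => \sum_i f i y *: w i); split=> [r y z Wy Wz|y Wy].
  rewrite scaler_sumr -big_split/=; apply: eq_bigr => i _.
  by rewrite lf// scalerDl scalerA.
have Ww i : W (f i y *: w i) by apply: submodZ => //; exact: (wP i).1.
split; first exact: submod_sum.
rewrite (linear_on_sum _ sW lphi)// [RHS]eE//; apply: eq_bigr => i _.
by have [Wwi <-] := wP i; rewrite (linear_onZ _ sW lphi).
Qed.

End FgProjective.

(** * Pure submodules *)

Section PureHull.
Variables (R : idomainType) (M : lmodType R).
Implicit Types (P W X Y : set M).

Definition rd_pure P : Prop := forall r x, r != 0 -> P (r *: x) -> P x.

Definition pure_hull X : set M :=
  [set x | exists2 r, r != 0 & lspan X (r *: x)].

Lemma submod_pure_hull X : submod (pure_hull X).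
Proof.
split=> [|c x y [r r0 Xx] [r' r'0 Xy]].
  by exists 1; rewrite ?oner_eq0// scaler0; exact: (submod0 (submod_lspan X)).
exists (r * r'); first by rewrite mulf_neq0.
have -> : (r * r') *: (c *: x + y) = (c * r') *: (r *: x) + r *: (r' *: y).
  by rewrite scalerDr !scalerA [_ * c]mulrC [r * r']mulrC mulrA.
by apply: (submodD (submod_lspan X)); exact: (submodZ _ (submod_lspan X)).
Qed.

Lemma lspan_sub_pure_hull X : lspan X `<=` pure_hull X.
Proof. by move=> x Xx; exists 1; rewrite ?oner_eq0// scale1r. Qed.

Lemma sub_pure_hull X : X `<=` pure_hull X.
Proof. by apply: subset_trans (@lspan_sub_pure_hull X); exact: sub_lspan. Qed.

Lemma rd_pure_hull X : rd_pure (pure_hull X).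
Proof.
move=> r x r0 [s s0 Xx]; exists (s * r); first by rewrite mulf_neq0.
by rewrite -scalerA.
Qed.

Lemma pure_hull_sub X P : submod P -> rd_pure P -> X `<=` P ->
  pure_hull X `<=` P.
Proof. by move=> sP pP XP x [r r0 /(lspan_sub sP XP)]; exact: pP. Qed.

Lemma pure_hull_mono : {homo pure_hull : X Y / X `<=` Y}.
Proof. by move=> X Y XY x [r r0 /(lspan_mono XY)]; exists r. Qed.

Lemma pure_hull_id P : submod P -> rd_pure P -> pure_hull P = P.
Proof.
move=> sP pP; apply/seteqP; split; last exact: sub_pure_hull.
exact: pure_hull_sub.
Qed.

Lemma pure_hull_cons P s g :
  pure_hull (P `|` [set` g :: s]) =
  pure_hull (pure_hull (P `|` [set` s]) `|` [set g]).
Proof.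
apply/seteqP; split; apply: pure_hull_sub.
- exact: submod_pure_hull.
- exact: rd_pure_hull.
- move=> x [Px|]; first by do 2![apply: sub_pure_hull; left].
  rewrite /= inE => /orP[/eqP ->|sx]; first by apply: sub_pure_hull; right.
  by apply: sub_pure_hull; left; apply: sub_pure_hull; right.
- exact: submod_pure_hull.
- exact: rd_pure_hull.
- move=> x [|->]; last by apply: sub_pure_hull; right; rewrite /= mem_head.
  by apply: pure_hull_mono => y [|sy]; [left | right; rewrite /= inE sy orbT].
Qed.

Lemma pure_hullU1 P g x : submod P ->
  pure_hull (P `|` [set g]) x <-> exists r s, r != 0 /\ P (r *: x - s *: g).
Proof.
move=> sP; split=> [[r r0 /lspan_setU[a [b [Pa gb xE]]]]|[r [s [r0 Px]]]].
  have [s bE] := lspan_set1 gb.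
  by exists r, s; rewrite xE bE addrK -(lspan_id sP).
exists r => //; rewrite -(subrK (s *: g) (r *: x)).
apply: (submodD (submod_lspan _)); first by apply: sub_lspan; left.
by apply: (submodZ _ (submod_lspan _)); apply: sub_lspan; right.
Qed.

Definition separated P W : Prop := forall w, W w -> ~ P w ->
  exists phi : M -> R,
    [/\ functional_on W phi, forall x, W x -> P x -> phi x = 0 & phi w != 0].

Lemma separated_pure_hullU1 P W g : submod W -> submod P -> rd_pure P -> W g ->
  separated P W -> separated (pure_hull (P `|` [set g])) W.
Proof.
move=> sW sP pP Wg sep; have [Pg|nPg] := pselect (P g).
  by rewrite (setUidl _) ?pure_hull_id// => _ ->.
have [phi [lphi Pphi phig]] := sep _ Wg nPg; set d := phi g in phig.
pose T v := d *: v - phi v *: g.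
have WT v : W v -> W (T v) by move=> Wv; apply: submodB => //; exact: submodZ.
have lT : linear_on W T.
  move=> r x y Wx Wy; rewrite /T lphi// scalerDl scalerDr opprD addrACA.
  by rewrite scalerBr !scalerA [d * r]mulrC.
move=> w Ww nPw; have nPTw : ~ P (T w).
  by move=> PTw; apply: nPw; apply/pure_hullU1 => //; exists d, (phi w).
have [psi [lpsi Ppsi psiTw]] := sep _ (WT _ Ww) nPTw.
have lpsiT : functional_on W (psi \o T).
  by move=> r x y Wx Wy; rewrite /= lT// lpsi//; exact: WT.
have PpsiT v : W v -> P v -> psi (T v) = 0.
  by move=> Wv Pv; rewrite Ppsi ?WT// /T Pphi// scale0r subr0; exact: submodZ.
exists (psi \o T); split=> // x Wx /(pure_hullU1 g x sP)[r [s [r0 Px]]].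
have := PpsiT _ (submodB sW (submodZ r sW Wx) (submodZ s sW Wg)) Px.
rewrite -[psi (T _)]/((psi \o T) _) (functional_onB lpsiT); [|exact: submodZ..].
rewrite !(functional_onZ _ sW lpsiT)//.
rewrite [(psi \o T) g]/= /T subrr (functional_on0 sW lpsi) mulr0 subr0.
by move=> /eqP; rewrite mulf_eq0 (negbTE r0) => /eqP.
Qed.

Hypothesis tfM : torsion_free M.

Lemma torsion_free_eq0 (r : R) (x : M) : r != 0 -> r *: x = 0 -> x = 0.
Proof. by move=> r0 /tfM[] // /eqP; rewrite (negbTE r0). Qed.

Lemma torsion_free_inj (r : R) : r != 0 -> injective (fun x : M => r *: x).
Proof.
move=> r0 x y /eqP; rewrite -subr_eq0 -scalerBr.
by move=> /eqP/(torsion_free_eq0 r0)/eqP; rewrite subr_eq0 => /eqP.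
Qed.

Lemma pure_is_rd_pure (S : submodClosed M) :
  pure S -> rd_pure [set x | x \in S].
Proof.
move=> pS r x r0 /= rxS.
have [//||y [yS]] := pS 1%N 1%N (const_mx r) (fun=> r *: x).
  by exists (fun=> x) => i; rewrite big_ord1 mxE.
move=> /(_ ord0); rewrite big_ord1 mxE => /(torsion_free_inj r0) <-.
exact: yS.
Qed.

End PureHull.

(** * Countable generation *)

Lemma countableU (T : Type) (A B : set T) :
  countable A -> countable B -> countable (A `|` B).
Proof.
move=> cA cB; have -> : A `|` B = \bigcup_b (if b then A else B).
  apply/seteqP; split=> [x [Ax|Bx]|x [[] _ ?]].
  - by exists true.
  - by exists false.
  - by left.
  - by right.
by apply: bigcup_countable => // -[].
Qed.

Lemma countable_closure (T : eqType) (x0 : T) (F : seq T -> set T) :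
  (forall s, countable (F s)) ->
  exists C, [/\ countable C, C x0 & forall s, [set` s] `<=` C -> F s `<=` C].
Proof.
move=> cF; have /choice[e eP] : forall s, exists e : nat -> T, F s `<=` range e.
  move=> s; have /pfcard_geP[->|/surjfunPex[e ->]] := cF s; last by exists e.
  by exists (fun=> x0).
(* The closure is the image of a countable type of trees. *)
pose eval := fix eval (t : GenTree.tree nat) : T :=
  match t with
  | GenTree.Leaf _ => x0
  | GenTree.Node k ts => e (map eval ts) k
  end.
exists (range eval); split.
- exact: sub_countable (card_image_le _ _) (countableP _).
- by exists (GenTree.Leaf 0%N).
move=> s sC; have [ts <-] : exists ts, map eval ts = s.
  elim: s sC => [|x s IH] sC; first by exists [::].
  have [t _ <-] : range eval x by apply: sC; rewrite /= mem_head.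
  have [|ts <-] := IH; last by exists (t :: ts).
  by move=> y sy; apply: sC; rewrite /= inE sy orbT.
by move=> _ /eP[k _ <-]; exists (GenTree.Node k ts).
Qed.

Definition ideals_fg_projective (R : pzRingType) : Prop :=
  forall J : set R^o, submod J -> fg_projective J.

(* Equivalently, the quotient field is a countably generated [R]-module. *)
Definition countable_denominators (R : pzRingType) : Prop :=
  exists D : set R, [/\ countable D, ~ D 0 &
    forall r, r != 0 -> exists2 d, D d & exists t, d = t * r].

Section CountablyGenerated.
Variables (R : idomainType) (M : lmodType R).
Implicit Types (P Q W : set M).

Definition countably_generated_over P Q : Prop :=
  exists2 C, countable C & Q `<=` lspan (P `|` C).

Lemma countably_generated_over_trans P Q W :
  countably_generated_over P Q -> countably_generated_over Q W ->
  countably_generated_over P W.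
Proof.
move=> [C cC QC] [E cE WE]; exists (C `|` E); first exact: countableU.
apply: subset_trans WE _; apply: lspan_sub => // x [Qx|Ex].
  by apply: lspan_mono (QC _ Qx); exact: setUS.
by apply: sub_lspan; right; right.
Qed.

Hypothesis ifgR : ideals_fg_projective R.

Lemma pure_hullU1_denominator_fg P g d : submod P -> rd_pure P -> d != 0 ->
  exists2 C, finite_set C &
    [set x | exists c, P (d *: x - c *: g)] `<=` lspan (P `|` C).
Proof.
move=> sP pP d0.
pose J : set R^o := [set c : R | exists x, P (d *: x - c *: g)].
have [|n [e [f [Je lf eE]]]] := ifgR (J := J).
  split=> [|r a b [x Px] [y Py]].
    by exists 0; rewrite scaler0 scale0r subr0; exact: submod0.
  exists (r *: x + y); rewrite scalerDr [(_ + b) *: g]scalerDl opprD addrACA.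
  have -> : d *: (r *: x) - (r * a) *: g = r *: (d *: x - a *: g).
    by rewrite scalerBr !scalerA mulrC.
  exact: submod_linear.
have /choice[w wP] : forall i, exists w, P (d *: w - e i *: g) by exact: Je.
exists (range w) => [|x [c Pc]]; first exact: finite_image.
have cE : c = \sum_i f i c * e i by apply: eE; exists x.
have sS := submod_lspan (P `|` range w).
rewrite -(subrK (\sum_i f i c *: w i) x); apply: (submodD sS); last first.
  apply: (submod_sum _ sS) => i _; apply: (submodZ _ sS).
  by apply: sub_lspan; right; exists i.
apply: sub_lspan; left; apply: (pP d) => //.
have -> : d *: (x - \sum_i f i c *: w i) =
          (d *: x - c *: g) - \sum_i f i c *: (d *: w i - e i *: g).
  rewrite scalerBr [X in X *: g]cE scaler_suml scaler_sumr -addrA -opprD.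
  rewrite -big_split/=; congr (_ - _); apply: eq_bigr => i _.
  by rewrite scalerBr !scalerA addrCA subrr addr0 mulrC.
by apply: submodB => //; apply: submod_sum => // i _; exact: submodZ.
Qed.

Hypothesis denR : countable_denominators R.

Lemma pure_hullU1_countable P g : submod P -> rd_pure P ->
  countably_generated_over P (pure_hull (P `|` [set g])).
Proof.
move=> sP pP; have [D [cD D0 dvdD]] := denR.
have /choice[C CP] : forall d, exists C, d != 0 -> finite_set C /\
    [set x | exists c, P (d *: x - c *: g)] `<=` lspan (P `|` C).
  move=> d; have [->|d0] := eqVneq d 0; first by exists set0.
  by have [C fC CP] := pure_hullU1_denominator_fg g sP pP d0; exists C.
have D_neq0 d : D d -> d != 0 by move=> Dd; apply/eqP => d0; rewrite d0 in Dd.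
exists (\bigcup_(d in D) C d).
  apply: bigcup_countable => // d /D_neq0/CP[fC _].
  exact: finite_set_countable.
move=> x /(pure_hullU1 g x sP)[r [s [r0 Px]]]; have [d Dd [t dE]] := dvdD r r0.
have /(CP d (D_neq0 d Dd)).2 : exists c, P (d *: x - c *: g).
  by exists (t * s); rewrite dE -!scalerA -scalerBr; exact: submodZ.
by apply: lspan_mono; apply: setUS => y Cy; exists d.
Qed.

Lemma pure_hull_countable P (s : seq M) : submod P -> rd_pure P ->
  countably_generated_over P (pure_hull (P `|` [set` s])).
Proof.
move=> sP pP; elim: s => [|g s IH].
  exists set0; first exact: countable0.
  by rewrite set_nil !setU0 pure_hull_id//; exact: sub_lspan.
rewrite pure_hull_cons; apply: countably_generated_over_trans IH _.
apply: pure_hullU1_countable; first exact: submod_pure_hull.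
exact: rd_pure_hull.
Qed.

End CountablyGenerated.

(** * Direct sums of lines *)

Section Lines.
Variables (R : idomainType) (M : lmodType R).
Implicit Types (b c x : M) (B : set M).

Definition line b : set M := pure_hull [set b].

Lemma lineP b x : line b x <-> exists r s, r != 0 /\ r *: x = s *: b.
Proof.
split=> [[r r0 /lspan_set1[s rx]]|[r [s [r0 rx]]]]; first by exists r, s.
exists r => //; rewrite rx.
by apply: (submodZ _ (submod_lspan _)); exact: sub_lspan.
Qed.

Lemma submod_line b : submod (line b). Proof. exact: submod_pure_hull. Qed.

Definition line_sum B : set M := lspan (\bigcup_(b in B) line b).

Lemma submod_line_sum B : submod (line_sum B). Proof. exact: submod_lspan. Qed.

Lemma line_sub_line_sum B b : B b -> line b `<=` line_sum B.
Proof. by move=> Bb x bx; apply: sub_lspan; exists b. Qed.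

Lemma line_sum_sub B W : submod W -> (forall b, B b -> line b `<=` W) ->
  line_sum B `<=` W.
Proof. by move=> sW BW; apply: lspan_sub => // x [b Bb]; exact: BW. Qed.

Lemma line_sum_mono : {homo line_sum : B B' / B `<=` B'}.
Proof. by move=> B B' BB'; apply: lspan_mono; exact: bigcup_subset. Qed.

Lemma line_sum_setU1 B c x : line_sum (B `|` [set c]) x ->
  exists u v, [/\ line_sum B u, line c v & x = u + v].
Proof.
rewrite /line_sum bigcup_setU bigcup_set1 => /lspan_setU[u [v [Bu cv ->]]].
by exists u, v; rewrite -(lspan_id (submod_line c)).
Qed.

Lemma line_sum_bigcup (F : set (set M)) (G : set M -> set M) : directed F G ->
  line_sum (\bigcup_(B in F) G B) `<=` \bigcup_(B in F) line_sum (G B).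
Proof.
move=> [F0 dirF]; rewrite /line_sum bigcup_bigcup; apply: lspan_bigcup.
split=> // B B' FB FB'; have [E [FE BE B'E]] := dirF B B' FB FB'.
by exists E; split=> //; exact: bigcup_subset.
Qed.

Lemma line_sum_finitary B x : line_sum B x -> exists (s : seq M) (y : M -> M),
  [/\ uniq s, forall b, b \in s -> B b, forall b, line b (y b) &
      x = \sum_(b <- s) y b].
Proof.
have line0 b : line b 0 := submod0 (submod_line b).
pose sums := [set x | exists (s : seq M) (y : M -> M),
  [/\ uniq s, forall b, b \in s -> B b, forall b, line b (y b) &
      x = \sum_(b <- s) y b]].
apply: (@line_sum_sub B sums) => [|b Bb z bz]; last first.
  exists [:: b], (fun c => if c == b then z else 0); split=> // [c|c|].
  - by rewrite inE => /eqP ->.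
  - by case: eqP => [->|].
  - by rewrite big_seq1 eqxx.
split=> [|r _ _ [s [y [us sB ly ->]]] [t [z [ut tB lz ->]]]].
  by exists [::], (fun=> 0); rewrite big_nil; split.
pose u := undup (s ++ t).
have extend (v : seq M) (w : M -> M) : uniq v -> {subset v <= u} ->
    \sum_(b <- v) w b = \sum_(b <- u) (if b \in v then w b else 0).
  move=> uv vu; rewrite -big_mkcond -big_filter; apply/perm_big/uniq_perm => //.
    by rewrite filter_uniq// undup_uniq.
  by move=> b; rewrite mem_filter andb_idr// => /vu.
have su : {subset s <= u} by move=> b sb; rewrite mem_undup mem_cat sb.
have tu : {subset t <= u} by move=> b tb; rewrite mem_undup mem_cat tb orbT.
pose y' b := if b \in s then y b else 0.
pose z' b := if b \in t then z b else 0.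
exists u, (fun b => r *: y' b + z' b); split=> [|b|b|]; first exact: undup_uniq.
- by rewrite mem_undup mem_cat => /orP[/sB|/tB].
- by apply: (submod_linear r (submod_line b)); rewrite /y' /z'; case: ifP.
- by rewrite (extend s y)// (extend t z)// scaler_sumr -big_split.
Qed.

(* Such a line is isomorphic to an ideal, through [x |-> s]. *)
Definition bounded_denominators b : Prop :=
  exists2 q, q != 0 & forall x, line b x -> exists s, q *: x = s *: b.

Definition line_basis B : Prop :=
  (forall b, B b -> b <> 0 /\ bounded_denominators b) /\
  forall b x, B b -> line b x -> line_sum (B `\ b) x -> x = 0.

Lemma line_basis_chain (F : set (set M)) : total_on F subset ->
  (forall B, F B -> line_basis B) -> line_basis (\bigcup_(B in F) B).
Proof.
move=> tF bF; split=> [b [B /bF[+ _] Bb]|b x [B FB Bb] bx]; first exact.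
rewrite setDE setI_bigcupl => /line_sum_bigcup[|B' FB' xB'].
  by apply: total_on_directed => //; [exists B | move=> X Y XY; exact: setSI].
have [BB'|B'B] := tF _ _ FB FB'.
  by apply: (bF _ FB').2 bx xB'; exact: BB'.
by apply: (bF _ FB).2 Bb bx _; apply: line_sum_mono xB'; exact: setSI.
Qed.

Lemma line_basis_setU1 B c : line_basis B -> c <> 0 -> bounded_denominators c ->
  (forall x, line_sum B x -> line c x -> x = 0) -> line_basis (B `|` [set c]).
Proof.
move=> [bB dB] c0 bc cB.
split=> [b [/bB //|-> //]|b x [Bb|->] bx xB]; last first.
  by apply: cB => //; apply: line_sum_mono xB => y [[]].
have /line_sum_setU1[u [v [Bu cv xE]]] : line_sum ((B `\ b) `|` [set c]) x.
  by apply: line_sum_mono xB => y [[By|->] yb]; [left | right].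
suff v0 : v = 0 by apply: dB Bb bx _; rewrite xE v0 addr0.
apply: cB => //; have -> : v = x - u by rewrite xE addrC addKr.
apply: (submodB (submod_line_sum _)); first exact: line_sub_line_sum bx.
by apply: line_sum_mono Bu => y [].
Qed.

Hypothesis tfM : torsion_free M.

Lemma line_functional b : b <> 0 -> bounded_denominators b ->
  exists phi : M -> R, functional_on (line b) phi /\
    forall x, line b x -> phi x = 0 -> x = 0.
Proof.
move=> b0 [q q0 qP].
have /choice[phi phiP] : forall x, exists s, line b x -> q *: x = s *: b.
  move=> x; have [/qP[s sE]|nbx] := pselect (line b x); first by exists s.
  by exists 0.
exists phi; split=> [r x y bx yb|x /phiP + phix]; last first.
  by rewrite phix scale0r; exact: (torsion_free_eq0 tfM q0).
have bxy := submod_linear r (submod_line b) bx yb.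
have [|/eqP|//] := tfM (r := phi (r *: x + y) - (r * phi x + phi y)) (x := b).
  rewrite scalerBl scalerDl -scalerA -!phiP// scalerDr !scalerA.
  by rewrite [q * r]mulrC subrr.
by rewrite subr_eq0 => /eqP.
Qed.

Lemma pure_hullU1_ker P g (phi : M -> R) x : submod P -> rd_pure P ->
  functional_on (pure_hull (P `|` [set g])) phi ->
  (forall y, P y -> phi y = 0) ->
  phi g != 0 -> pure_hull (P `|` [set g]) x -> phi x = 0 -> P x.
Proof.
move=> sP pP lphi Pphi phig Qx; have sQ := submod_pure_hull (P `|` [set g]).
have [r [s [r0 Px]]] := (pure_hullU1 g x sP).1 Qx => phix.
have Qg : pure_hull (P `|` [set g]) g by apply: sub_pure_hull; right.
have := Pphi _ Px; rewrite (functional_onB lphi); [|exact: submodZ..].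
rewrite !(functional_onZ _ sQ lphi)// phix mulr0 sub0r => /eqP.
rewrite oppr_eq0 mulf_eq0 (negbTE phig) orbF => /eqP s0.
by apply: (pP r) => //; rewrite s0 scale0r subr0 in Px.
Qed.

Lemma line_section (W : set M) (phi : M -> R) (sigma : R -> M) (d : R) :
  submod W -> rd_pure W -> functional_on W phi ->
  linear_on ((phi : M -> R^o) @` W) (sigma : R^o -> M) ->
  (forall y, (phi @` W) y -> W (sigma y) /\ phi (sigma y) = y) ->
  (phi @` W) d -> d != 0 ->
  (forall x, line (sigma d) x ->
    [/\ W x, x = sigma (phi x) & d *: x = phi x *: sigma d]) /\
  (forall y, (phi @` W) y -> line (sigma d) (sigma y)).
Proof.
move=> sW pW lphi lsigma sigmaK Wd d0.
have sJ : submod (phi @` W : set R^o) := submod_image sW lphi.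
have sigmaZ r y : (phi @` W) y -> sigma (r * y) = r *: sigma y.
  exact: (linear_onZ r sJ lsigma).
have [Wc phic] := sigmaK d Wd.
split=> [x /lineP[r [s [r0 rxE]]]|y Wy]; last first.
  by apply/lineP; exists d, y; split=> //; rewrite -!sigmaZ// mulrC.
have Wx : W x by apply: (pW r) => //; rewrite rxE; exact: submodZ.
have Wphix : (phi @` W) (phi x) by exists x.
have xE : x = sigma (phi x).
  apply: (torsion_free_inj tfM r0).
  rewrite /= -sigmaZ// -(functional_onZ _ sW lphi)// rxE.
  by rewrite (functional_onZ _ sW lphi)// phic sigmaZ.
by split=> //; rewrite {1}xE -!sigmaZ// mulrC.
Qed.

Hypothesis ifgR : ideals_fg_projective R.

(* The image of [phi] is an ideal, so [phi] splits; the new line is the image of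
   the splitting. *)
Lemma line_basis_pure_hullU1 B g (phi : M -> R) :
  line_basis B -> rd_pure (line_sum B) ->
  functional_on (pure_hull (line_sum B `|` [set g])) phi ->
  (forall x, line_sum B x -> phi x = 0) -> phi g != 0 ->
  exists c, line_basis (B `|` [set c]) /\
    line_sum (B `|` [set c]) = pure_hull (line_sum B `|` [set g]).
Proof.
set P := line_sum B; set Q := pure_hull _ => bB pP lphi Pphi phig.
have sP : submod P by exact: submod_line_sum.
have sQ : submod Q by exact: submod_pure_hull.
have PQ : P `<=` Q by move=> x Px; apply: sub_pure_hull; left.
have Jg : (phi @` Q) (phi g) by exists g => //; apply: sub_pure_hull; right.
have [sigma [lsigma sigmaK]] :=
  fg_projective_section sQ lphi (ifgR (submod_image sQ lphi)).
have [lineE line_sigma] :=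
  line_section sQ (@rd_pure_hull _ _ _) lphi lsigma sigmaK Jg phig.
set c := sigma (phi g) in lineE line_sigma; exists c; split.
  apply: line_basis_setU1 => //.
  - move=> c0; have [_] := sigmaK _ Jg.
    rewrite -/c c0 (functional_on0 sQ lphi) => /eqP.
    by rewrite eq_sym (negbTE phig).
  - by exists (phi g) => // x /lineE[_ _ ->]; exists (phi x).
  - move=> x Px /lineE[_ _]; rewrite (Pphi x)// scale0r.
    exact: (torsion_free_eq0 tfM phig).
apply/seteqP; split=> x.
  by move=> /line_sum_setU1[u [v [/PQ Qu /lineE[Qv _ _] ->]]]; exact: submodD.
move=> Qx; have [Qs phis] : Q (sigma (phi x)) /\ phi (sigma (phi x)) = phi x.
  by apply: sigmaK; exists x.
rewrite -(subrK (sigma (phi x)) x).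
apply: (submodD (submod_line_sum _)); last first.
  by apply: (@line_sub_line_sum _ c); [right | apply: line_sigma; exists x].
apply: (@line_sum_mono B); first by left.
apply: (pure_hullU1_ker sP pP lphi Pphi phig); first exact: submodB.
by rewrite (functional_onB lphi)// phis subrr.
Qed.

End Lines.

(** * Coordinates *)

Section Coordinates.
Variables (R : idomainType) (M : lmodType R) (I : choiceType).
Variables (N : set M) (l : I -> M -> R).
Implicit Types (A : set M).

Definition axis (i : I) : set M :=
  [set z | N z /\ forall j, j != i -> l j z = 0].

Definition coordinates : Prop :=
  [/\ forall i, functional_on N (l i),
      forall x, N x -> (forall i, l i x = 0) -> x = 0,
      forall x, N x -> finite_set [set i | l i x != 0] &
      forall x i, N x -> exists2 y, axis i y & l i y = l i x].

Hypothesis sN : submod N.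
Hypothesis lN : coordinates.

Lemma coordinates_inj x y : N x -> N y -> (forall i, l i x = l i y) -> x = y.
Proof.
have [fl il _ _] := lN => Nx Ny lxy; apply/eqP; rewrite -subr_eq0; apply/eqP/il.
  exact: submodB.
by move=> i; rewrite (functional_onB (fl i))// lxy subrr.
Qed.

Lemma coord_axis_sum (s : seq I) (y : I -> M) j :
  uniq s -> (forall i, axis i (y i)) ->
  l j (\sum_(i <- s) y i) = if j \in s then l j (y j) else 0.
Proof.
have [fl _ _ _] := lN => us ay.
apply: functional_on_sum_single sN (fl j) us _ _.
  by move=> i; exact: (ay i).1.
by move=> i _ ij; apply: (ay i).2; rewrite eq_sym.
Qed.

Lemma axes_generate A x : submod A -> N x ->
  (forall i, l i x != 0 -> axis i `<=` A) -> A x.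
Proof.
have [_ _ fin_l cl] := lN => sA Nx xA.
have /finite_seqP[s /seteqP[supp_s s_supp]] := fin_l x Nx.
have /choice[y yP] : forall i, exists y, axis i y /\ l i y = l i x.
  by move=> i; have [y] := cl x i Nx; exists y.
have suppE i : (i \in undup s) = (l i x != 0).
  by rewrite mem_undup; apply/idP/idP => [/s_supp|/supp_s].
have -> : x = \sum_(i <- undup s) y i.
  apply: coordinates_inj => // [|i].
    by apply: submod_sum => // i _; exact: (yP i).1.1.
  rewrite coord_axis_sum ?undup_uniq// => [|j]; last exact: (yP j).1.
  by rewrite suppE (yP i).2; case: eqP => //= ->.
rewrite big_seq; apply: submod_sum => // i; rewrite suppE => lx.
by apply: (xA i) => //; exact: (yP i).1.
Qed.

Lemma axis_sub_line i c : axis i c -> l i c != 0 -> axis i `<=` line c.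
Proof.
have [fl _ _ _] := lN => -[Nc ac] lc z [Nz az]; apply/lineP.
exists (l i c), (l i z); split=> //.
apply: coordinates_inj => [||j]; [exact: submodZ..|].
rewrite !(functional_onZ _ sN (fl j))//.
have [->|ji] := eqVneq j i; first exact: mulrC.
by rewrite (az j)// (ac j)// !mulr0.
Qed.

Definition axis_closed A : Prop := forall y i,
  A y -> N y -> l i y != 0 -> axis i `<=` A.

Lemma axis_separated A : submod A -> axis_closed A ->
  separated A (lspan (A `|` N)).
Proof.
have [fl _ _ _] := lN => sA aA w /(lspan_submodU sA sN)[a [m [Aa Nm ->]]] nAam.
have [i [lm nAi]] : exists i, l i m != 0 /\ ~ (axis i `<=` A).
  apply: contrapT => axesA; apply: nAam; apply: submodD => //.
  apply: axes_generate => // i lm; apply: contrapT => nAi.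
  by apply: axesA; exists i.
have lA y : A y -> N y -> 0 = l i y.
  by move=> Ay Ny; apply/esym/eqP; apply: contrapT => /negP/(aA y i Ay Ny).
have [|phi [lphi phiA phiN]] := linear_on_glue sA sN _ (fl i) lA.
  by move=> r x y _ _; rewrite scaler0 addr0.
exists phi; split=> // [x _|]; first exact: phiA.
rewrite (linear_onD lphi) ?(phiA a)// ?(phiN m)// ?add0r//; apply: sub_lspan.
  by left.
by right.
Qed.

Lemma pure_hull_support A (s : seq M) :
  submod A -> rd_pure A -> axis_closed A ->
  exists2 K, finite_set K & forall y i, N y -> pure_hull (A `|` [set` s]) y ->
    l i y != 0 -> K i \/ axis i `<=` A.
Proof.
have [fl _ sl _] := lN => sA pA aA; elim: s => [|g s [K fK KP]].
  exists set0 => // y i Ny; rewrite set_nil setU0 pure_hull_id// => Ay ly.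
  by right; exact: (aA y).
rewrite pure_hull_cons; set P := pure_hull (A `|` [set` s]) in KP *.
have sP : submod P by exact: submod_pure_hull.
have [[z [Nz Pz nPz]]|NP] :=
    pselect (exists z, [/\ N z, pure_hull (P `|` [set g]) z & ~ P z]);
    last first.
  exists K => // y i Ny Py; apply: KP => //.
  by apply: contrapT => nPy; apply: NP; exists y.
exists (K `|` [set i | l i z != 0]).
  by rewrite finite_setU; split=> //; exact: sl.
move=> y i Ny /(pure_hullU1 g y sP)[r [t [r0 Py]]] ly.
have [lz|lz] := eqVneq (l i z) 0; last by left; right.
have [r' [t' [r'0 Pz']]] := (pure_hullU1 g z sP).1 Pz.
have t'0 : t' != 0.
  apply: contra_notN nPz => /eqP t'0; apply: (@rd_pure_hull _ _ _ r') => //.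
  by rewrite t'0 scale0r subr0 in Pz'.
(* [u] cancels the component of [y] along [g] and keeps its [i]-th coordinate *)
pose u := (t' * r) *: y - (t * r') *: z.
have Nu : N u by apply: submodB => //; exact: submodZ.
have Pu : P u.
  have -> : u = t' *: (r *: y - t *: g) - t *: (r' *: z - t' *: g).
    by rewrite !scalerBr !scalerA opprB addrA [t' * t]mulrC subrK.
  by apply: submodB => //; exact: submodZ.
have [|Ki|] := KP u i Nu Pu; [|by left; left|by right].
rewrite (functional_onB (fl i)); [|exact: submodZ..].
by rewrite !(functional_onZ _ sN (fl i))// lz mulr0 subr0 !mulf_neq0.
Qed.

Lemma pure_hull_axes A (s : seq M) :
  submod A -> rd_pure A -> axis_closed A ->
  exists2 C, finite_set C & forall y i, N y -> pure_hull (A `|` [set` s]) y ->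
    l i y != 0 -> axis i `<=` pure_hull (A `|` C).
Proof.
have [_ _ _ cl] := lN => sA pA aA.
have [K fK KP] := pure_hull_support s sA pA aA.
have /choice[c cP] : forall i, exists c,
    forall y, N y -> l i y != 0 -> axis i c /\ l i c != 0.
  move=> i; have [[y [Ny ly]]|Ni] := pselect (exists y, N y /\ l i y != 0).
    by have [c ac lc] := cl y i Ny; exists c => _ _ _; rewrite lc.
  by exists 0 => y Ny ly; case: Ni; exists y.
exists (c @` K) => [|y i Ny Py ly]; first exact: finite_image.
have [Ki|iA] := KP y i Ny Py ly; last first.
  by move=> z /iA Az; apply: sub_pure_hull; left.
have [ac lc] := cP i y Ny ly; apply: subset_trans (axis_sub_line ac lc) _.
by apply: pure_hull_mono => _ ->; right; exists i.
Qed.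

End Coordinates.

(** * Extending a decomposition by countably many elements *)

Lemma dependent_choice (T : Type) (P : T -> Prop)
    (step : nat -> T -> T -> Prop) x0 :
  P x0 -> (forall k x, P x -> exists y, P y /\ step k x y) ->
  exists u : nat -> T,
    [/\ u 0%N = x0, forall k, P (u k) & forall k, step k (u k) (u k.+1)].
Proof.
move=> Px0 stepP.
have /choice[f fP] : forall kx : nat * T, exists y,
    P kx.2 -> P y /\ step kx.1 kx.2 y.
  move=> [k x]; have [/(stepP k)[y]|nPx] := pselect (P x); first by exists y.
  by exists x0.
pose u := fix u k := if k is k'.+1 then f (k', u k') else x0.
have Pu k : P (u k) by elim: k => //= k /(fP (k, _))[].
by exists u; split=> // k; exact: (fP (k, u k) (Pu k)).2.
Qed.

Section CountableExtension.
Variables (R : idomainType) (M : lmodType R).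
Hypothesis tfM : torsion_free M.
Hypothesis ifgR : ideals_fg_projective R.
Variable W : nat -> set M.
Hypothesis submodW : forall n, submod (W n).
Hypothesis rd_pureW : forall n, rd_pure (W n).
Hypothesis W_mono : forall m n, (m <= n)%N -> W m `<=` W n.
Hypothesis W_cover : forall x, exists n, W n x.
Implicit Types (B C P : set M).

Definition eventually_separated P : Prop :=
  exists n0, forall n, (n0 <= n)%N -> P `<=` W n /\ separated P (W n).

Lemma line_basis_extend B g : line_basis B -> rd_pure (line_sum B) ->
  eventually_separated (line_sum B) ->
  exists B', [/\ B `<=` B', line_basis B',
    line_sum B' = pure_hull (line_sum B `|` [set g]) &
    eventually_separated (line_sum B')].
Proof.
move=> bB pB sepB; have sB := submod_line_sum B.
have [Bg|nBg] := pselect (line_sum B g).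
  by exists B; split=> //; rewrite (setUidl _) ?pure_hull_id// => _ ->.
have [n0 n0P] := sepB; have [m Wmg] := W_cover g; pose n1 := maxn n0 m.
have Wg n : (n1 <= n)%N -> W n g.
  by rewrite geq_max => /andP[_ mn]; exact: W_mono Wmg.
have [BW sepW] : (forall n, (n1 <= n)%N -> line_sum B `<=` W n) /\
    forall n, (n1 <= n)%N -> separated (line_sum B) (W n).
  by split=> n; rewrite geq_max => /andP[/n0P[]].
have QW n : (n1 <= n)%N -> pure_hull (line_sum B `|` [set g]) `<=` W n.
  move=> n1n; apply: pure_hull_sub => // x [/(BW n n1n)//|->]; exact: Wg.
have [phi [lphi phiB phig]] := sepW n1 (leqnn _) g (Wg _ (leqnn _)) nBg.
have [|x Bx|c [bBc BcE]] := line_basis_pure_hullU1 tfM ifgR bB pB _ _ phig.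
- exact: linear_on_sub (QW n1 _) lphi.
- by apply: phiB => //; exact: BW Bx.
exists (B `|` [set c]); split=> //; exists n1 => n n1n; rewrite BcE.
split; first exact: QW.
by apply: separated_pure_hullU1 => //; [exact: Wg | exact: sepW].
Qed.

Lemma line_basis_extend_countable B C : line_basis B -> rd_pure (line_sum B) ->
  eventually_separated (line_sum B) -> countable C ->
  exists B', [/\ B `<=` B', line_basis B' &
    line_sum B' = pure_hull (line_sum B `|` C)].
Proof.
move=> bB pB sepB /pfcard_geP[->|/surjfunPex[e ->]].
  by exists B; split=> //; rewrite setU0 pure_hull_id//; exact: submod_line_sum.
pose extendable B1 := [/\ line_basis B1, rd_pure (line_sum B1) &
  eventually_separated (line_sum B1)].
pose adjoins k B1 B2 := B1 `<=` B2 /\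
  line_sum B2 = pure_hull (line_sum B1 `|` [set e k]).
have [//|k B1 [bB1 pB1 sepB1]|u [u0 uP uS]] :=
    @dependent_choice _ extendable adjoins B.
  have [B2 [B12 bB2 B2E sepB2]] := line_basis_extend (e k) bB1 pB1 sepB1.
  by exists B2; split=> //; split=> //; rewrite B2E; exact: rd_pure_hull.
have u_mono j k : (j <= k)%N -> u j `<=` u k.
  move=> /subnK <-; elim: (k - j)%N => // i IH x /IH; exact: (uS _).1.
pose F := range u; have tF : total_on F subset.
  move=> _ _ [j _ <-] [k _ <-].
  by have [jk|/ltnW kj] := leqP j k; [left|right]; exact: u_mono.
have dirF : directed F id by apply: total_on_directed => //; exists B, 0%N.
have u_line_sum k : line_sum (u k) `<=` line_sum (\bigcup_(X in F) X).
  by apply: line_sum_mono => x ukx; exists (u k) => //; exists k.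
exists (\bigcup_(X in F) X); split.
- by move=> x Bx; exists B => //; exists 0%N.
- by apply: line_basis_chain => // _ [k _ <-]; case: (uP k).
apply/seteqP; split=> [x /(line_sum_bigcup dirF)[_ [k _ <-]]|].
  elim: k x => [|k IH]; first by rewrite u0 => x Bx; apply: sub_pure_hull; left.
  rewrite (uS k).2; apply: pure_hull_sub.
  - exact: submod_pure_hull.
  - exact: rd_pure_hull.
  - by move=> x [/IH//|->]; apply: sub_pure_hull; right; exists k.
apply: pure_hull_sub; first exact: submod_line_sum.
  move=> r x r0 /(line_sum_bigcup dirF)[_ [k _ <-] ukx]; apply: (u_line_sum k).
  by have [_ puk _] := uP k; exact: puk ukx.
move=> x [|[k _ <-]]; first by rewrite -u0; exact: u_line_sum.
by apply: (u_line_sum k.+1); rewrite (uS k).2; apply: sub_pure_hull; right.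
Qed.

End CountableExtension.

(** * Good submodules *)

Section GoodSubmodules.
Variables (R : idomainType) (M : lmodType R).
Variables (N : nat -> set M) (I : nat -> choiceType).
Variable l : forall n, I n -> M -> R.
Hypothesis submodN : forall n, submod (N n).
Hypothesis coordinatesN : forall n, coordinates (N n) (@l n).
Hypothesis N0 : N 0%N `<=` [set 0].
Implicit Types (A B C : set M).

(* Modulo a good submodule, the chain [N] keeps its two properties: purity, and
   decomposability by a subset of the given summands. *)
Definition good A : Prop := submod A /\ forall n,
  rd_pure (lspan (A `|` N n)) /\ axis_closed (N n) (@l n) A.

Lemma lspan_setU_N0 A : submod A -> lspan (A `|` N 0%N) = A.
Proof.
move=> sA; rewrite (setUidl _) ?lspan_id// => _ /N0 ->; exact: submod0.
Qed.

Lemma good_rd_pure A : good A -> rd_pure A.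
Proof. by move=> [sA /(_ 0%N)[]]; rewrite lspan_setU_N0. Qed.

Lemma good0 : (forall n, rd_pure (N n)) -> good [set 0].
Proof.
move=> pN; split=> [|n]; first exact: submod_set0.
split; first by rewrite (setUidr _) ?lspan_id// => _ ->; exact: submod0.
have [fl _ _ _] := coordinatesN n.
by move=> _ i -> _; rewrite (functional_on0 (submodN n) (fl i)) eqxx.
Qed.

Lemma good_bigcup (T : Type) (D : set T) (A : T -> set M) : directed D A ->
  (forall j, D j -> good (A j)) -> good (\bigcup_(j in D) A j).
Proof.
move=> dirA gA; have sA : submod (\bigcup_(j in D) A j).
  by apply: submod_bigcup => // j /gA[].
split=> // n; split=> [r x r0 /(lspan_submodU sA (submodN n))|].
  move=> [a [b [[j Dj Aa] Nb xE]]]; have [sAj /(_ n)[pAj _]] := gA j Dj.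
  apply: (@lspan_mono _ _ (A j `|` N n)); first by apply: setSU => y; exists j.
  apply: (pAj r) => //; rewrite xE; apply: (submodD (submod_lspan _)).
    by apply: sub_lspan; left.
  by apply: sub_lspan; right.
move=> y i [j Dj Ay] Ny ly z az; exists j => //.
by have [_ /(_ n)[_ aAj]] := gA j Dj; exact: aAj Ay Ny ly z az.
Qed.

Definition absorbs A (s : seq M) C : Prop := forall n,
  pure_hull (lspan (A `|` N n) `|` [set` s]) `<=`
    lspan (lspan (A `|` N n) `|` C) /\
  forall y i, N n y -> pure_hull (A `|` [set` s]) y -> l i y != 0 ->
    axis (N n) (@l n) i `<=` pure_hull (A `|` C).

Lemma absorbs_sub A s C C' : C `<=` C' -> absorbs A s C -> absorbs A s C'.
Proof.
move=> CC' absC n; have [hullC axisC] := absC n; split.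
  by apply: subset_trans hullC _; apply: lspan_mono; exact: setUS.
move=> y i Ny Ay ly; apply: subset_trans (axisC y i Ny Ay ly) _.
by apply: pure_hull_mono; exact: setUS.
Qed.

Lemma good_lspan A C : good A -> (forall s, [set` s] `<=` C -> absorbs A s C) ->
  good (lspan (A `|` C)).
Proof.
move=> [sA _] absC; set S := lspan (A `|` C).
have sS : submod S by exact: submod_lspan.
have AS : A `<=` S by move=> y Ay; apply: sub_lspan; left.
have CS : C `<=` S by move=> y Cy; apply: sub_lspan; right.
have pSN n : rd_pure (lspan (S `|` N n)).
  move=> r y r0 /(lspan_submodU sS (submodN n))[a [m [Sa Nm yE]]].
  have [s sC sa] := lspan_finitary Sa.
  have : pure_hull (lspan (A `|` N n) `|` [set` s]) y.
    exists r => //; rewrite yE; apply: (submodD (submod_lspan _)).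
      by apply: lspan_mono sa; apply: setSU => z Az; apply: sub_lspan; left.
    by apply: sub_lspan; left; apply: sub_lspan; right.
  move=> /(absC s sC n).1; apply: lspan_sub => // z [|/CS Sz].
    by apply: lspan_mono; exact: setSU.
  by apply: sub_lspan; left.
have pS : rd_pure S by have := pSN 0%N; rewrite lspan_setU_N0.
split=> // n; split=> // y i /lspan_finitary[s sC sy] Ny ly.
apply: subset_trans ((absC s sC n).2 y i Ny (lspan_sub_pure_hull sy) ly) _.
by apply: pure_hull_sub => // z [/AS|/CS].
Qed.

Hypothesis ifgR : ideals_fg_projective R.
Hypothesis denR : countable_denominators R.

Lemma exists_countable_absorbs A s : good A ->
  exists2 C, countable C & absorbs A s C.
Proof.
move=> gA; have [sA /all_and2[pAN aA]] := gA; have pA := good_rd_pure gA.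
have /choice[C1 /all_and2[cC1 C1P]] : forall n, exists C, countable C /\
    pure_hull (lspan (A `|` N n) `|` [set` s]) `<=`
      lspan (lspan (A `|` N n) `|` C).
  move=> n; have sAN := submod_lspan (A `|` N n).
  by have [C] := pure_hull_countable ifgR denR s sAN (pAN n); exists C.
have /choice[C2 /all_and2[fC2 C2P]] : forall n, exists C, finite_set C /\
    forall y i, N n y -> pure_hull (A `|` [set` s]) y -> l i y != 0 ->
      axis (N n) (@l n) i `<=` pure_hull (A `|` C).
  move=> n; have [C] :=
    pure_hull_axes (submodN n) (coordinatesN n) s sA pA (aA n).
  by exists C.
exists (\bigcup_n (C1 n `|` C2 n)) => [|n].
  apply: bigcup_countable => // n _; apply: countableU => //.
  exact: finite_set_countable.
split=> [|y i Ny Ay ly].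
  apply: subset_trans (C1P n) _; apply: lspan_mono; apply: setUS => x C1x.
  by exists n => //; left.
apply: subset_trans (C2P n y i Ny Ay ly) _; apply: pure_hull_mono.
by apply: setUS => x C2x; exists n => //; right.
Qed.

Lemma good_extend A x : good A ->
  exists C, [/\ countable C, good (lspan (A `|` C)) & C x].
Proof.
move=> gA; have /choice[F /all_and2[cF FP]] : forall s : seq M, exists C,
    countable C /\ absorbs A s C.
  by move=> s; have [C] := exists_countable_absorbs s gA; exists C.
have [C [cC Cx FC]] := countable_closure x cF; exists C; split=> //.
by apply: good_lspan => // s /FC FsC; exact: absorbs_sub FsC (FP s).
Qed.

End GoodSubmodules.

Section LineBasisOfChain.
Variables (R : idomainType) (M : lmodType R).
Hypothesis tfM : torsion_free M.
Hypothesis ifgR : ideals_fg_projective R.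
Hypothesis denR : countable_denominators R.
Variables (N : nat -> set M) (I : nat -> choiceType).
Variable l : forall n, I n -> M -> R.
Hypothesis submodN : forall n, submod (N n).
Hypothesis rd_pureN : forall n, rd_pure (N n).
Hypothesis coordinatesN : forall n, coordinates (N n) (@l n).
Hypothesis N0 : N 0%N `<=` [set 0].
Hypothesis N_mono : forall m n, (m <= n)%N -> N m `<=` N n.
Hypothesis N_cover : forall x, exists n, N n x.

Lemma good_line_basis_extend (B : set M) x :
  line_basis B -> good N l (line_sum B) ->
  exists B', [/\ B `<=` B', line_basis B', good N l (line_sum B') &
    line_sum B' x].
Proof.
move=> bB gB; have [sB BN] := gB; pose W n := lspan (line_sum B `|` N n).
have [C [cC gC Cx]] := good_extend submodN coordinatesN N0 ifgR denR x gB.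
have [n|n|m n mn|y|||B' [BB' bB' B'E]] :=
    @line_basis_extend_countable _ _ tfM ifgR W _ _ _ _ B C bB _ _ cC.
- exact: submod_lspan.
- exact: (BN n).1.
- by apply: lspan_mono; apply: setUS; exact: N_mono.
- by have [n Ny] := N_cover y; exists n; apply: sub_lspan; right.
- exact: good_rd_pure gB.
- exists 0%N => n _; split; first by move=> y By; apply: sub_lspan; left.
  exact: axis_separated (BN n).2.
have pC : pure_hull (line_sum B `|` C) = lspan (line_sum B `|` C).
  apply/seteqP; split; last exact: lspan_sub_pure_hull.
  apply: pure_hull_sub; first exact: submod_lspan.
    exact: good_rd_pure gC.
  exact: sub_lspan.
by exists B'; rewrite B'E pC; split=> //; apply: sub_lspan; right.
Qed.

Lemma good_line_sum_chain (F : set (set M)) : total_on F subset ->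
  (forall B, F B -> good N l (line_sum B)) ->
  good N l (line_sum (\bigcup_(B in F) B)).
Proof.
move=> tF gF; have [->|F0] := eqVneq F set0.
  by rewrite bigcup_set0 /line_sum bigcup_set0 lspan_set0; exact: good0.
have dirF G : {homo G : X Y / X `<=` Y} -> @directed _ M F G.
  by apply: total_on_directed => //; exact/set0P.
have -> : line_sum (\bigcup_(B in F) B) = \bigcup_(B in F) line_sum B.
  apply/seteqP; split; first by apply: line_sum_bigcup; exact: dirF.
  by move=> x [B FB]; apply: line_sum_mono; exact: bigcup_sup FB.
by apply: good_bigcup => //; apply: dirF; exact: line_sum_mono.
Qed.

Lemma exists_line_basis : exists2 B : set M, line_basis B & line_sum B = setT.
Proof.
have [F FP tF|B [[bB gB] maxB]] := @Zorn_bigcup M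
    [set B | line_basis B /\ good N l (line_sum B)].
  split; first by apply: line_basis_chain => // B /FP[].
  by apply: good_line_sum_chain => // B /FP[].
exists B => //; apply/seteqP; split=> // x _; apply: contrapT => nBx.
have [B' [BB' bB' gB' B'x]] := good_line_basis_extend x bB gB.
apply: (maxB B') => //; split=> // B'B; apply: nBx; exact: line_sum_mono B'x.
Qed.

End LineBasisOfChain.

(** * Dedekind domains *)

Section DirectSumCoefficients.
Variables (R : comNzRingType) (I : Type) (J : I -> ideal R).

Definition direct_sum_coef (h : direct_sum J) (i : I) : R := val h i.

Lemma direct_sum_coef_linear r (g h : direct_sum J) i :
  direct_sum_coef (r *: g + h) i =
  r * direct_sum_coef g i + direct_sum_coef h i.
Proof. by []. Qed.

Lemma direct_sum_coefZ r (h : direct_sum J) i :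
  direct_sum_coef (r *: h) i = r * direct_sum_coef h i.
Proof. by []. Qed.

Lemma direct_sum_coef_in (h : direct_sum J) i :
  (direct_sum_coef h i : R^o) \in J i.
Proof. by have /asboolP[] := valP h. Qed.

Lemma direct_sum_coef_finite (h : direct_sum J) :
  finite_set [set i | direct_sum_coef h i != 0].
Proof. by have /asboolP[_] := valP h; apply: sub_finite_set => i /= /eqP. Qed.

Lemma direct_sum_ext (g h : direct_sum J) :
  (forall i, direct_sum_coef g i = direct_sum_coef h i) -> g = h.
Proof. by move=> gh; apply/val_inj/funext. Qed.

Lemma direct_sum_build (f : I -> R) : (forall i, (f i : R^o) \in J i) ->
  finite_set [set i | f i != 0] -> exists h, direct_sum_coef h = f.
Proof.
move=> fJ ff; have fP : (f : I -> R^o) \in in_direct_sum J.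
  by apply/asboolP; split=> //; apply: sub_finite_set ff => i /= /eqP.
by exists (exist _ (f : I -> R^o) fP).
Qed.

End DirectSumCoefficients.

Section ExtensionByZero.
Variables (R : pzRingType) (V U : lmodType R) (S : submodClosed V).

Definition extend0 (f : submodule S -> U) (x : V) : U := oapp f 0 (insub x).

Lemma extend0_val f (u : submodule S) : extend0 f (val u) = f u.
Proof. by rewrite /extend0 valK. Qed.

Lemma submodule_val x : x \in S -> exists u : submodule S, val u = x.
Proof. by move=> Sx; exists (exist _ x Sx). Qed.

Lemma linear_on_extend0 f : linear f -> linear_on [set x | x \in S] (extend0 f).
Proof.
move=> lf r _ _ /submodule_val[u <-] /submodule_val[v <-].
by rewrite -[_ + _]/(val (r *: u + v)) !extend0_val lf.
Qed.

End ExtensionByZero.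

Section FreeCover.
Variables (R : comNzRingType) (V : lmodType R).

Definition whole_ideal : ideal R := submod_pred (submod_setT R^o).

Definition free_on : lmodType R := direct_sum (fun _ : V => whole_ideal).

Definition free_eval (h : free_on) : V :=
  \sum_(i \in [set: V]) direct_sum_coef h i *: i.

Lemma free_evalE (h : free_on) (s : seq V) :
  (forall i, direct_sum_coef h i != 0 -> i \in s) ->
  free_eval h = \sum_(i <- undup s) direct_sum_coef h i *: i.
Proof.
move=> hs; rewrite /free_eval (fsbigE (undup s)) ?undup_uniq//.
  by apply: eq_bigl => i; rewrite in_setT.
move=> i _; rewrite mem_undup => /negP nis.
have -> : direct_sum_coef h i = 0 by apply/eqP; apply: contra_notT nis => /hs.
by rewrite scale0r.
Qed.

Lemma free_on_support (h : free_on) :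
  exists s : seq V, forall i, direct_sum_coef h i != 0 -> i \in s.
Proof.
by have /finite_seqP[s /seteqP[hs _]] := direct_sum_coef_finite h; exists s.
Qed.

Fact free_eval_linear : linear free_eval.
Proof.
move=> r g h; have [s gs] := free_on_support g.
have [t ht] := free_on_support h.
rewrite !(@free_evalE _ (s ++ t)) => [|i|i|i]; last 3 first.
- by rewrite mem_cat => /ht ->; rewrite orbT.
- by rewrite mem_cat => /gs ->.
- rewrite mem_cat direct_sum_coef_linear; apply: contraNT => /norP[nis nit].
  have /eqP -> : direct_sum_coef g i == 0 by apply: contraNT nis => /gs.
  have /eqP -> : direct_sum_coef h i == 0 by apply: contraNT nit => /ht.
  by rewrite mulr0 addr0.
rewrite scaler_sumr -big_split/=; apply: eq_bigr => i _.
by rewrite direct_sum_coef_linear scalerDl scalerA.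
Qed.

HB.instance Definition _ :=
  GRing.isLinear.Build R free_on V _ free_eval free_eval_linear.

Lemma free_eval_surj v : exists h, free_eval h = v.
Proof.
have [i||h hE] := @direct_sum_build _ _ (fun _ : V => whole_ideal)
    (fun i => (i == v)%:R).
- exact/in_submod_pred.
- apply: (@sub_finite_set _ _ [set v]) => // i /=.
  by case: (eqVneq i v); rewrite ?eqxx.
exists h; rewrite (@free_evalE _ [:: v]) => [|i]; rewrite hE.
  by rewrite big_seq1 eqxx scale1r.
by rewrite inE; case: (i == v); rewrite ?eqxx.
Qed.

End FreeCover.

Lemma dedekind_ideals_fg_projective (R : idomainType) :
  dedekind_domain R -> ideals_fg_projective R.
Proof.
move=> ddR J sJ; pose S : ideal R := submod_pred sJ; pose T := submodule S.
have [[a Ja a0]|J0] := pselect (exists2 a : R, J a & a != 0); last first.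
  exists 0%N, (fun=> 0), (fun _ _ => 0); split=> [[]//|[]//|x Jx].
  rewrite big_ord0; apply/eqP; apply: contrapT => /negP x0.
  by apply: J0; exists x.
have [h hP] := ddR S (free_on T) T (@free_eval R T) idfun (@free_eval_surj R T).
have lift y : J y -> exists u : T, val u = y.
  by move=> Jy; apply: submodule_val; exact/in_submod_pred.
have [a' a'E] := lift a Ja.
have [s sP] := free_on_support (h a').
(* [a *: y = val y *: a'], so [h a'] has the largest support. *)
have hs (y : T) i : direct_sum_coef (h y) i != 0 -> i \in s.
  move=> hyi; apply: sP; have : a *: y = (val y : R) *: a'.
    by apply: val_inj; rewrite !linearZ/= a'E; exact: mulrC.
  move=> /(congr1 (fun u => direct_sum_coef (h u) i)).
  rewrite !linearZ !direct_sum_coefZ => haE.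
  by apply: contraNneq (mulf_neq0 a0 hyi) => ha0; rewrite haE ha0 mulr0.
pose t := in_tuple (undup s).
pose f i := extend0 (fun y : T => direct_sum_coef (h y) (tnth t i) : R^o).
exists (size (undup s)), (fun i => val (tnth t i)), f; split=> [i|i|x Jx].
- by have /asboolP := valP (tnth t i).
- apply: linear_on_sub (@linear_on_extend0 _ _ _ S _ _) => [x Jx|r y z].
    exact/in_submod_pred.
  by rewrite linearP direct_sum_coef_linear.
have [y <-] := lift x Jx.
have := etrans (esym (free_evalE (hs y))) (hP y).
move=> /(congr1 (fun u : T => val u : R^o)).
rewrite (big_morph (fun u : T => val u : R^o) (fun _ _ => erefl) erefl).
move=> evalE; rewrite -[LHS]evalE big_tnth; apply: eq_bigr => i _.
by rewrite /f extend0_val.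
Qed.

Lemma submod_avoiding (R : pzRingType) (V : lmodType R) (A D : set V) :
  submod A -> A `<=` ~` D -> exists K, [/\ submod K, A `<=` K, K `<=` ~` D &
    forall K', submod K' -> K `<=` K' -> K' `<=` ~` D -> K' `<=` K].
Proof.
move=> sA AD; have [F FP tF|X [XD maxX]] := @Zorn_bigcup V
    [set X | lspan (A `|` X) `<=` ~` D].
  have [->|/set0P F0] := eqVneq F set0.
    by rewrite /= bigcup_set0 setU0 lspan_id.
  have dirF : directed F (fun X => A `|` X).
    by apply: total_on_directed => // X Y; exact: setUS.
  suff AF : A `|` \bigcup_(X in F) X `<=` \bigcup_(X in F) (A `|` X).
    move=> x /(lspan_mono AF)/(lspan_bigcup dirF)[X /FP]; exact.
  case: F0 => Y FY x [Ax|[X FX Xx]]; first by exists Y => //; left.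
  by exists X => //; right.
exists (lspan (A `|` X)); split=> //.
  by move=> x Ax; apply: sub_lspan; left.
move=> K' sK' AXK' K'D x K'x.
have AK' : A `|` X `<=` K' by apply: subset_trans AXK'; exact: sub_lspan.
apply: contrapT => nAXx; apply: (maxX K').
  split=> [y Xy|K'X]; first by apply: AK'; right.
  by apply: nAXx; apply: sub_lspan; right; exact: K'X.
apply: subset_trans K'D; apply: lspan_sub => // y [Ay|//].
by apply: AK'; left.
Qed.

Lemma maximal_ideal_above (R : comNzRingType) (K : set R^o) :
  submod K -> ~ K 1 ->
  exists2 J : ideal R, maximal_ideal J & K `<=` [set x | x \in J].
Proof.
move=> sK K1; have [|P [sP KP P1 maxP]] := @submod_avoiding _ _ K [set 1] sK.
  by move=> x Kx x1; apply: K1; rewrite -x1.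
exists (submod_pred sP : ideal R) => [|x /KP Px]; last exact/in_submod_pred.
split=> [|J PJ [x nJx] y Jy].
  by exists 1; apply/negP => /in_submod_pred /P1; exact.
apply/in_submod_pred; apply: (maxP [set x | x \in J]) => //.
- exact: submod_submodClosed.
- by move=> z Pz; apply: PJ; exact/in_submod_pred.
- move=> z Jz z1; case/negP: nJx; rewrite -[x]mulr1 -[1]z1.
  exact: (rpredZ x).
Qed.

Lemma maximal_ideal_proper (R : comNzRingType) (J : ideal R) :
  maximal_ideal J -> (1 : R^o) \notin J.
Proof.
move=> [[x nJx] _]; apply: contra nJx => J1; rewrite -[x]mulr1.
exact: (rpredZ x).
Qed.

Section IdealProduct.
Variables (R : idomainType).
Implicit Types (J K P : set R^o).

Definition idealM K P : set R^o :=
  lspan (V := R^o) [set (x : R) * y | x in K & y in P].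

Lemma ideal_functionalC J (u : R -> R) x y : submod J -> functional_on J u ->
  J x -> J y -> u x * y = u y * x.
Proof.
move=> sJ lu Jx Jy; rewrite [LHS]mulrC [RHS]mulrC -!(functional_onZ _ sJ lu)//.
by congr u; exact: mulrC.
Qed.

Lemma sub_idealM_colon K P q :
  submod K -> submod P -> fg_projective P -> K `<=` P -> P q ->
  (forall y, K (y * q) -> K y) -> K `<=` idealM K P.
Proof.
move=> sK sP [n [e [f [Pe lf eE]]]] KP Pq Kq x Kx.
rewrite [x]eE; last exact: KP.
apply: (submod_sum _ (submod_lspan _)) => i _; apply: sub_lspan.
exists (f i x); last by exists (e i).
apply: Kq; rewrite (ideal_functionalC sP (lf i) (KP x Kx) Pq).
exact: (submodZ _ sK Kx).
Qed.

(* The trace of the identity of [K], computed on a dual basis, is 1; all of its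
   terms lie in [P]. *)
Lemma idealM_cancel K P r : submod K -> submod P -> fg_projective K ->
  K r -> r != 0 -> K `<=` idealM K P -> P 1.
Proof.
move=> sK sP [n [e [f [Ke lf eE]]]] Kr r0 KKP.
have Pf u x : functional_on K u -> K x -> P (u x).
  move=> lu /KKP KPx.
  pose A := [set x | K x /\ P (u x)]; suff [] : A x by [].
  apply: (@lspan_sub _ _ _ A) KPx => [|_ [y Ky [z Pz <-]]].
    split=> [|c y z [Ky Py] [Kz Pz]]; rewrite /A /=.
      rewrite (functional_on0 sK lu).
      by split; [exact: (submod0 sK) | exact: (submod0 sP)].
    rewrite lu//.
    by split; [exact: (submod_linear c sK) | exact: (submod_linear c sP)].
  split; first by rewrite mulrC; exact: (submodZ z sK Ky).
  rewrite mulrC (functional_onZ z sK lu)// mulrC; exact: (submodZ _ sP Pz).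
have -> : 1 = \sum_i f i (e i).
  apply: (mulfI r0); rewrite mulr1 {1}[r]eE// mulr_sumr; apply: eq_bigr => i _.
  by rewrite [LHS](ideal_functionalC sK (lf i))// mulrC.
by apply: (submod_sum _ sP) => i _; exact: Pf.
Qed.

End IdealProduct.

(* Choose a nonzero element in each maximal ideal.  An ideal [K] that is maximal
   among those avoiding the products of these elements satisfies [K = K J] for
   every maximal [J] containing it, contrary to the invertibility of [K]. *)
Lemma dedekind_countable_denominators (R : idomainType) :
  ideals_fg_projective R ->
  countable [set J : ideal R | maximal_ideal J] -> countable_denominators R.
Proof.
move=> ifgR cR.
have /choice[p pP] : forall J : ideal R, exists p : R, p != 0 /\
    forall x : R, x != 0 -> (x : R^o) \in J -> (p : R^o) \in J.
  move=> J; have [[x x0 Jx]|J0] :=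
    pselect (exists2 x : R, x != 0 & (x : R^o) \in J); first by exists x.
  by exists 1; rewrite oner_eq0; split=> // x x0 Jx; case: J0; exists x.
have [s|E [cE E1 pE]] := @countable_closure R 1 (fun s =>
    [set p J * head 1 s | J in [set J : ideal R | maximal_ideal J]]).
  exact: sub_countable (card_image_le _ _) cR.
pose D : set R^o := [set x : R | E x /\ x != 0]; exists D; split.
- by apply: sub_countable cE; apply: subset_card_le => x [].
- by move=> [_]; rewrite eqxx.
move=> r r0; apply: contrapT => nDr.
pose rR : set R^o := [set t * r | t in [set: R]].
have [||K [sK rK KD maxK]] := @submod_avoiding _ _ rR D.
- split=> [|c _ _ [t _ <-] [u _ <-]]; first by exists 0; rewrite ?mul0r.
  by exists (c * t + u); rewrite // mulrDl -mulrA.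
- by move=> _ [t _ <-] Dtr; apply: nDr; exists (t * r) => //; exists t.
have Kr : K r by apply: rK; exists 1; rewrite ?mul1r.
have [|J mJ KJ] := maximal_ideal_above sK.
  by move=> /KD; apply; split=> //; exact: oner_neq0.
have /negP := maximal_ideal_proper mJ; apply.
have sJ : submod [set x | x \in J] := submod_submodClosed J.
apply: (idealM_cancel sK sJ (ifgR K sK) Kr r0).
have [q0 Jq] := pP J; set q := p J in q0 Jq.
apply: (sub_idealM_colon sK sJ (ifgR _ sJ) KJ (Jq r r0 (KJ _ Kr))) => y.
apply: (maxK [set y : R | K (y * q : R)]).
- split=> [|c x z Kx Kz] /=; first by rewrite mul0r; exact: (submod0 sK).
  by rewrite mulrDl -mulrA; exact: (submod_linear c sK Kx Kz).
- by move=> x Kx /=; rewrite mulrC; exact: (submodZ q sK Kx).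
- move=> x Kx [Ex x0]; apply: (KD _ Kx); split; last by rewrite mulf_neq0.
  apply: (pE [:: x]); last by exists J => //; exact: mulrC.
  by move=> z; rewrite /= inE => /eqP ->.
Qed.

(** * Coordinates and direct sums of ideals *)

Lemma iso_coordinates (R : idomainType) (M : lmodType R) (S : submodClosed M) :
  iso_direct_sum_of_ideals (submodule S) ->
  exists (I : choiceType) (l : I -> M -> R), coordinates [set x | x \in S] l.
Proof.
move=> [I [J [f [g fK gK]]]].
pose l i := extend0 (fun u => direct_sum_coef (f u) i : R^o).
have lE i u : l i (val u) = direct_sum_coef (f u) i := extend0_val _ u.
exists {classic I}, l; split.
- move=> i; apply: linear_on_extend0 => r u v.
  by rewrite linearP direct_sum_coef_linear.
- move=> _ /submodule_val[u <-] lu0; suff -> : u = 0 by [].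
  by apply: (can_inj fK); apply: direct_sum_ext => i; rewrite -lE lu0 linear0.
- move=> _ /submodule_val[u <-].
  by apply: sub_finite_set (direct_sum_coef_finite (f u)) => i; rewrite /= lE.
move=> _ i /submodule_val[u <-].
pose h (j : {classic I}) : R := if j == i then direct_sum_coef (f u) i else 0.
have [j||v vE] := @direct_sum_build _ _ J h.
- rewrite /h; case: eqVneq => [->|_]; last exact: rpred0.
  exact: direct_sum_coef_in.
- apply: (@sub_finite_set _ _ [set i]) => // j /=.
  by rewrite /h; case: (eqVneq j i) => [-> //|_]; rewrite eqxx.
exists (val (g v)); last by rewrite !lE gK vE /h eqxx.
by split=> [|j /negbTE ji]; [exact: (valP (g v)) | rewrite lE gK vE /h ji].
Qed.

Lemma coordinates_iso (R : idomainType) (M : lmodType R) (I : choiceType)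
    (l : I -> M -> R) :
  coordinates [set: M] l -> iso_direct_sum_of_ideals M.
Proof.
move=> lM; have sM := submod_setT M; have [fl _ sl cl] := lM.
pose J i : ideal R := submod_pred (submod_image sM (fl i)).
have /choice[F FP] : forall x, exists h : direct_sum J,
    direct_sum_coef h = l^~ x.
  move=> x; apply: direct_sum_build => [i|]; last exact: sl.
  by apply/in_submod_pred; exists x.
have FE x i : direct_sum_coef (F x) i = l i x by rewrite FP.
have F_linear : linear F.
  move=> r x y; apply: direct_sum_ext => i.
  by rewrite direct_sum_coef_linear !FE (fl i).
have F_inj : injective F.
  by move=> x y Fxy; apply: (coordinates_inj sM lM) => // i; rewrite -!FE Fxy.
have /choice[G GK] : forall h, exists x, F x = h.
  move=> h; have /finite_seqP[s /seteqP[supp_s _]] := direct_sum_coef_finite h.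
  have /choice[y yP] : forall i, exists y,
      axis setT l i y /\ l i y = direct_sum_coef h i.
    move=> i; have /in_submod_pred[x _ <-] := direct_sum_coef_in h i.
    by have [//|y] := cl x i; exists y.
  exists (\sum_(i <- undup s) y i); apply: direct_sum_ext => j; rewrite FE.
  rewrite (coord_axis_sum sM lM) ?undup_uniq// => [|i]; last exact: (yP i).1.
  rewrite mem_undup (yP j).2; case: ifPn => // js.
  by apply/esym/eqP; apply: contraNT js => /supp_s.
pose F' : {linear M -> direct_sum J} :=
  HB.pack F (GRing.isLinear.Build R M (direct_sum J) _ F F_linear).
by exists I, J, F', G => //= x; apply: F_inj; rewrite GK.
Qed.

Section LineBasisCoordinates.
Variables (R : idomainType) (M : lmodType R) (B : set M).
Hypothesis tfM : torsion_free M.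
Hypothesis basisB : line_basis B.
Hypothesis spanB : line_sum B = setT.

Lemma line_basis_coordinate b : exists phi : M -> R,
  [/\ functional_on setT phi,
      forall c x, B c -> c != b -> line c x -> phi x = 0 &
      B b -> forall x, line b x -> phi x = 0 -> x = 0].
Proof.
have [Bb|nBb] := pselect (B b); last first.
  by exists (fun=> 0); split=> // r x y _ _; rewrite scaler0 addr0.
have [linesB directB] := basisB; have [b0 bounded_b] := linesB b Bb.
have [psi [lpsi psi_inj]] := line_functional tfM b0 bounded_b.
have sC := submod_line_sum (B `\ b).
have [|x bx Cx|phi [lphi phi_psi phi0]] :=
    linear_on_glue (submod_line b) sC lpsi (g := fun=> 0).
- by move=> r x y _ _; rewrite scaler0 addr0.
- by rewrite (directB b x Bb bx Cx) (functional_on0 (submod_line b) lpsi).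
exists phi; split=> [r x y _ _|c x Bc cb cx|_ x bx]; last 2 first.
- by apply: phi0; apply: line_sub_line_sum cx; split=> //; exact/eqP.
- by rewrite phi_psi//; exact: psi_inj.
have BT z : lspan (line b `|` line_sum (B `\ b)) z.
  have : line_sum B z by rewrite spanB.
  apply: line_sum_sub z => [|c Bc z cz]; first exact: submod_lspan.
  apply: sub_lspan; have [<-|cb] := eqVneq c b; first by left.
  by right; apply: line_sub_line_sum cz; split=> //; exact/eqP.
exact: lphi.
Qed.

Lemma line_basis_coordinates : exists l : M -> M -> R, coordinates [set: M] l.
Proof.
have /choice[l lP] := line_basis_coordinate.
have fl b : functional_on setT (l b) by have [] := lP b.
have finitary x : line_sum B x by rewrite spanB.
have axis_line b y : B b -> line b y -> axis setT l b y.
  move=> Bb yb; split=> // c cb; have [_ + _] := lP c.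
  by apply; [exact: Bb | rewrite eq_sym |].
have coord_sum (s : seq M) y b : uniq s -> (forall c, c \in s -> B c) ->
    (forall c, line c (y c)) ->
    l b (\sum_(c <- s) y c) = if b \in s then l b (y b) else 0.
  move=> us sB ly.
  apply: functional_on_sum_single (submod_setT M) (fl b) us _ _.
    by [].
  by move=> c /sB Bc cb; have [_ + _] := lP b; apply; [exact: Bc | |].
exists l; split=> // [x _ lx|x _|x b _];
  have [s [y [us sB ly xE]]] := line_sum_finitary (finitary x).
- rewrite xE big_seq big1// => b sb; have [_ _ l_inj] := lP b.
  apply: l_inj => //; first exact: sB.
  by rewrite -[RHS](lx b) xE coord_sum// sb.
- apply: sub_finite_set (finite_seq s) => b /=; rewrite xE coord_sum//.
  by case: ifP => //; rewrite eqxx.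
- rewrite xE coord_sum//; case: ifPn => [/sB Bb|_].
    by exists (y b) => //; exact: axis_line.
  exists 0; last exact: functional_on0 (fl b).
  by split=> // c _; exact: functional_on0 (fl c).
Qed.

End LineBasisCoordinates.

Theorem corollary13 (R : idomainType) (M : lmodType R)
    (N : nat -> submodClosed M) :
  dedekind_domain R ->
  countable [set J : ideal R | maximal_ideal J]%classic ->
  torsion_free M ->
  (forall x : M, x \in N 0%N <-> x = 0) ->
  (forall n : nat, {subset N n <= N n.+1}) ->
  (forall x : M, exists n : nat, x \in N n) ->
  (forall n : nat, iso_direct_sum_of_ideals (submodule (N n))) ->
  (forall n : nat, pure (N n)) ->
  iso_direct_sum_of_ideals M.
Proof.
move=> /dedekind_ideals_fg_projective ifgR cR tfM N0 NS N_cover isoN pureN.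
have denR := dedekind_countable_denominators ifgR cR.
have /choice[Il IlP] : forall n, exists Il : {I : choiceType & I -> M -> R},
    coordinates [set x | x \in N n] (projT2 Il).
  move=> n; have [I [l lP]] := iso_coordinates (isoN n).
  by exists (existT _ I l).
have [|||m n /subnK <- x /=|B basisB spanB] :=
  exists_line_basis tfM ifgR denR (N := fun n => [set x | x \in N n])
    (l := fun n => projT2 (Il n)) _ _ IlP _ _ N_cover.
- by move=> n; exact: submod_submodClosed.
- by move=> n; exact: pure_is_rd_pure.
- by move=> x /N0.
- by elim: (n - m)%N => // k IH /IH; exact: NS.
have [l lM] := line_basis_coordinates tfM basisB spanB.
exact: coordinates_iso lM.
Qed.
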